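(* A tropical oriented matroid is completely determined by its vertices. To be precise: if $M$ is a tropical oriented matroid with parameters $(n,d)$, then every type $A\in M$ is a refinement of some vertex of $M$.
   Context: Write $[d]=\{1,\ldots,d\}$. An $(n,d)$-type is an $n$-tuple $(A_1,\ldots,A_n)$ of nonempty subsets of $[d]$. Comparability graph: given two $(n,d)$-types $A$ and $B$, the comparability graph $CG_{A,B}$ has vertex set $[d]$; for each $1\le i\le n$, and each $j\in A_i$, $k\in B_i$, draw an edge between $j$ and $k$, which is undirected if $j,k\in A_i\cap B_i$ and directed $j\to k$ otherwise (multiple edges are allowed). A directed path from $a$ to $b$ in such a graph with directed and undirected edges is a sequence of vertices $w_0=a,w_1,\ldots,w_k=b$ and edges $e_1,\ldots,e_k$, at least one of which is directed, such that each $e_i$ is either a directed edge from $w_{i-1}$ to $w_i$ or an undirected edge joining them. A directed cycle is a directed path with identical endpoints; the graph is acyclic if it has no directed cycle. Refinement: the refinement of an $(n,d)$-type $A=(A_1,\ldots,A_n)$ with respect to an ordered partition $(P_1,\ldots,P_r)$ of $[d]$ is $B=(A_1\cap P_{m(1)},\ldots,A_n\cap P_{m(n)})$, where $m(i)$ is the largest index for which $A_i\cap P_{m(i)}$ is nonempty. (The trivial partition $([d])$ is allowed, so a type is a refinement of itself.) A tropical oriented matroid $M$ with parameters $(n,d)$ is a collection of $(n,d)$-types satisfying: (Boundary) for each $j\in[d]$, the type $(j,j,\ldots,j)$ (every coordinate equal to the singleton $\{j\}$) is in $M$; (Elimination) for any $A,B\in M$ and any position $j\in[n]$ there is $C\in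 M$ with $C_j=A_j\cup B_j$ and $C_k\in\{A_k,B_k,A_k\cup B_k\}$ for all $k\in[n]$; (Comparability) for any $A,B\in M$ the comparability graph $CG_{A,B}$ is acyclic; (Surrounding) if $A\in M$, then every refinement of $A$ is in $M$. For a type $A$, let $G_A$ be the undirected graph with vertex set $[d]$ in which $i$ and $j$ are joined if there is a coordinate $A_k$ with $i,j\in A_k$. A vertex of $M$ is a type $A\in M$ such that $G_A$ is connected. *)

(* Defs.v *)
From HB Require Import structures.
From mathcomp Require Import all_boot.

Set Implicit Arguments.
Unset Strict Implicit.
Unset Printing Implicit Defensive.

(* The index sets [n] and [d] are 'I_n and 'I_d, numbered from 0. *)
Record nd_type (n d : nat) := NdType {
  nd_val :> {ffun 'I_n -> {set 'I_d}};
  _ : [forall i, nd_val i != set0]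
}.

HB.instance Definition _ n d := [isSub for @nd_val n d].
HB.instance Definition _ n d := [Finite of nd_type n d by <:].

Lemma const_nd_type_subproof (n d : nat) (j : 'I_d) :
  [forall i, [ffun _ : 'I_n => [set j]] i != set0].
Proof. by apply/forallP => i; rewrite ffunE; apply/set0Pn; exists j; rewrite set11. Qed.

Definition const_nd_type (n d : nat) (j : 'I_d) : nd_type n d :=
  NdType (const_nd_type_subproof n j).

Section Comparability.
Variables (n d : nat) (A B : nd_type n d).

(* The triple (i, j, k) is the edge drawn between j and k because
   j \in A i and k \in B i; the coordinate i keeps multiple edges apart. *)
Definition cg_edges : {set 'I_n * 'I_d * 'I_d} :=
  [set e | let: (i, j, k) := e in (j \in A i) && (k \in B i)].

Definition cg_undirected (e : 'I_n * 'I_d * 'I_d) : bool :=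
  let: (i, j, k) := e in (j \in A i :&: B i) && (k \in A i :&: B i).

Definition cg_traverses (e : 'I_n * 'I_d * 'I_d) (u v : 'I_d) : bool :=
  let: (_, j, k) := e in
  ((u == j) && (v == k)) || [&& cg_undirected e, u == k & v == j].

(* The walk w_0 = a, e_1, w_1, ..., e_k, w_k = b is given by a, b and the
   sequence of the pairs (e_i, w_i). *)
Fixpoint cg_walk (a : 'I_d) (s : seq ('I_n * 'I_d * 'I_d * 'I_d)) (b : 'I_d) :
    bool :=
  if s is (e, w) :: s' then
    [&& e \in cg_edges, cg_traverses e a w & cg_walk w s' b]
  else a == b.

Definition cg_directed_path (a b : 'I_d) : Prop :=
  exists2 s, cg_walk a s b & has (fun x => ~~ cg_undirected x.1) s.

Definition cg_acyclic : Prop := forall a : 'I_d, ~ cg_directed_path a a.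

End Comparability.

Definition ordered_partition (d : nat) (P : seq {set 'I_d}) : bool :=
  uniq P && partition [set:: P] [set: 'I_d].

Definition last_block (d : nat) (P : seq {set 'I_d}) (X : {set 'I_d}) : nat :=
  \max_(m < size P | X :&: nth set0 P m != set0) m.

Definition refine (n d : nat) (A : nd_type n d) (P : seq {set 'I_d}) :
    {ffun 'I_n -> {set 'I_d}} :=
  [ffun i => A i :&: nth set0 P (last_block P (A i))].

Definition refinement (n d : nat) (B A : nd_type n d) : Prop :=
  exists2 P, ordered_partition P & nd_val B = refine A P.

Record tropical_oriented_matroid (n d : nat) (M : {set nd_type n d}) : Prop := {
  tom_boundary : forall j : 'I_d, const_nd_type n j \in M;
  tom_elimination : forall A B : nd_type n d, A \in M -> B \in M ->
    forall j : 'I_n, exists C : nd_type n d,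
      [/\ C \in M, C j = A j :|: B j &
          forall k : 'I_n, C k \in [:: A k; B k; A k :|: B k]];
  tom_comparability : forall A B : nd_type n d, A \in M -> B \in M ->
    cg_acyclic A B;
  tom_surrounding : forall A B : nd_type n d, A \in M -> refinement B A ->
    B \in M
}.

Definition type_adj (n d : nat) (A : nd_type n d) : rel 'I_d :=
  fun i j => [exists k, (i \in A k) && (j \in A k)].

Definition tom_vertex (n d : nat) (M : {set nd_type n d}) (A : nd_type n d) :
    Prop :=
  A \in M /\ forall i j : 'I_d, connect (type_adj A) i j.

(* Main.v *)
Require Import Defs.
From mathcomp Require Import all_boot.
From mathcomp Require Import zify.

Set Implicit Arguments.
Unset Strict Implicit.
Unset Printing Implicit Defensive.

(** Think of a type A of M as the cell of a point x in an arrangement of n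
    tropical hyperplanes: A k is the set of coordinates at which x minus the
    apex of the k-th hyperplane is maximal. If the graph of A is disconnected
    and J is a union of its components, then x can slide in the direction of J:
    its type stays A for a while, until some coordinate set disjoint from J
    picks up elements of J. The type at that moment is a proper coarsening of
    which A is a refinement. A coarsening of A in M with the largest total
    size is therefore a vertex.

    The sliding is carried out as follows. [contraction] provides the type B
    at the far end of the ray: all its sets lie in J, and those sets of A
    that lie in J are unchanged. Given B, repeatedly eliminating between A and
    the current type gives a type which at every position is A k or
    A k :|: B k, and is not A ([eliminate_towards], [coarsen_disconnected]).

    The existence of B is the heart of the matter, proved by induction on the
    size of the set, called L in that proof. Let I be the set of positions k
    with A k inside L. Attach to a type C with all sets inside L the polytope
    which is the Minkowski sum, over k in I, of #|A k| times the simplex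
    spanned by C k, and let v be the sum over k in I of the indicator vectors
    of A k. By Hall's theorem, v lies in the polytope of C iff [excess] never
    exceeds the sum of the #|A k|.
    - Some C in M satisfies this ([excess_bounded]). Otherwise take an
      inequality violated by the maximal amount, at a set X. Refining C away
      from X makes L :\: X a union of components, the induction hypothesis
      gives the far end in the direction of this smaller set, and sliding
      towards it strictly relaxes the inequality at X. A modular identity
      ([excess_refine]) shows that, for X of maximal cardinality, no other
      inequality becomes violated by that amount, so the descent terminates.
    - If v lies in the polytope of C, acyclicity of the comparability graph
      forces A k to lie in C k for k in I ([excess_bounded_sub]): along the
      sets closed under reachability, the inequalities are tight.
    - A type containing A at the positions of I refines to one equal to A
      there, again by acyclicity ([refine_to_sub]). *)

(** * Refinements as maximisers of a weight *)

Section Refinement.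
Variables n d : nat.
Implicit Types (w : 'I_d -> nat) (A B C : nd_type n d) (X Y J : {set 'I_d}).

Lemma nd_type_neq0 A k : A k != set0.
Proof. by case: A => f /= /forallP. Qed.

Definition top_set w X : {set 'I_d} :=
  [set x in X | [forall y in X, w y <= w x]].

Lemma top_setP w X x :
  reflect (x \in X /\ forall y, y \in X -> w y <= w x) (x \in top_set w X).
Proof.
by rewrite inE; apply: (iffP andP) => -[xX] => [/forall_inP|/forall_inP].
Qed.

Lemma top_set_sub w X : top_set w X \subset X.
Proof. by apply/subsetP => x /top_setP[]. Qed.

Lemma top_set_neq0 w X : X != set0 -> top_set w X != set0.
Proof.
case/set0Pn=> x0 x0X; apply/set0Pn.
by case: (arg_maxnP w x0X) => x xX xmax; exists x; apply/top_setP; split.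
Qed.

(** Two successive refinements are one refinement: order lexicographically,
    by scaling the first weight beyond the range of the second. *)
Lemma top_set_comp w1 w2 X :
  top_set w2 (top_set w1 X) =
  top_set (fun x => w1 x * (\max_y w2 y).+1 + w2 x) X.
Proof.
set N := _.+1; have w2N y : w2 y < N by rewrite ltnS leq_bigmax.
apply/setP => x; apply/top_setP/top_setP => [[/top_setP[xX w1x] w2x]|[xX wx]].
  split=> // y yX; have := w1x y yX; rewrite leq_eqVlt => /orP[/eqP w1y|w1y].
    rewrite w1y leq_add2l; apply: w2x; apply/top_setP; split=> // z zX.
    by rewrite w1y w1x.
  have := w2N y; nia.
have w1x y : y \in X -> w1 y <= w1 x.
  by move/wx => wxy; have := w2N x; nia.
split=> [|y /top_setP[yX w1y]]; first exact/top_setP.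
have w1E : w1 y = w1 x by apply/anti_leq; rewrite w1x // w1y.
by have := wx y yX; rewrite w1E leq_add2l.
Qed.

Lemma top_set_indicator J X :
  top_set (fun x => x \in J) X = if X :&: J == set0 then X else X :&: J.
Proof.
apply/setP => x; case: (set_0Vmem (X :&: J)) => [XJ0|[z zXJ]].
  rewrite XJ0 eqxx; apply/top_setP/idP => [[]//|xX]; split=> // y yX.
  have /setP/(_ y) := XJ0; rewrite in_setI in_set0 yX /= => -> //.
have /set0Pn/negbTE -> : exists y, y \in X :&: J by exists z.
move: zXJ; rewrite in_setI => /andP[zX zJ].
apply/top_setP/setIP => [[xX /(_ z zX)]|[xX xJ]]; rewrite ?zJ ?xJ.
  by case: (x \in J).
by split=> // y _; case: (y \in J).
Qed.

(** Here [w x] is the index of the block that contains [x], so that the last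
    block meeting [X] is the one where [w] is maximal on [X]. *)
Lemma last_block_top P w X :
    (forall x, w x < size P) ->
    (forall x m, m < size P -> (x \in nth set0 P m) = (w x == m)) ->
  X != set0 -> X :&: nth set0 P (last_block P X) = top_set w X.
Proof.
move=> w_lt wP /(top_set_neq0 w)/set0Pn[z /top_setP[zX zmax]].
have -> : last_block P X = w z.
  apply/eqP; rewrite eqn_leq; apply/andP; split.
    apply/bigmax_leqP => m /set0Pn[x /setIP[xX]].
    by rewrite wP // => /eqP <-; exact: zmax.
  rewrite /last_block; apply: (@leq_bigmax_cond _ _ _ (Ordinal (w_lt z))).
  by apply/set0Pn; exists z; rewrite inE zX wP //= eqxx.
apply/setP => x; rewrite inE wP //; apply/andP/top_setP => -[xX wx].
  by split=> // y yX; rewrite (eqP wx) zmax.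
by split=> //; rewrite eqn_leq zmax //= wx.
Qed.

(** Weights are easier to handle than ordered partitions: they may have empty
    or missing levels, and compose by [top_set_comp]. A partition gives the
    weight that sends a point to the index of its block; a weight gives the
    partition into its nonempty level sets, in increasing order. *)
Lemma refinement_topP A B :
  refinement B A <-> exists w, forall k, B k = top_set w (A k).
Proof.
split=> [[P /andP[Puniq Ppart] BP]|[w Bw]].
  have /and3P[/eqP Pcov Ptriv _] := Ppart.
  pose w (x : 'I_d) := find (fun Q : {set 'I_d} => x \in Q) P.
  have hasP x : has (fun Q : {set 'I_d} => x \in Q) P.
    have : x \in cover [set:: P] by rewrite Pcov inE.
    by case/bigcupP => Q; rewrite inE => QP xQ; apply/hasP; exists Q.
  have w_lt x : w x < size P by rewrite -has_find.
  have xw x : x \in nth set0 P (w x) by exact: (nth_find set0 (hasP x)).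
  exists w => k; rewrite BP ffunE.
  apply: last_block_top (nd_type_neq0 A k) => // x m m_lt.
  apply/idP/eqP => [xm|<- //].
  apply/eqP; rewrite -(nth_uniq set0 _ m_lt Puniq) //.
  apply/idPn => /(trivIsetP Ptriv _ _ _ _)/pred0Pn[]; rewrite ?inE ?mem_nth //.
  by exists x; rewrite !inE xw.
pose s := sort leq (undup (codom w)).
have mem_s x : w x \in s by rewrite mem_sort mem_undup codom_f.
have s_uniq : uniq s by rewrite sort_uniq undup_uniq.
have s_sorted : sorted leq s by apply: sort_sorted; exact: leq_total.
pose level v := [set x | w x == v].
have level_inj : {in s &, injective level}.
  move=> u v; rewrite mem_sort mem_undup => /codomP[x ->] _ /setP/(_ x).
  by rewrite !inE eqxx => /esym/eqP.
pose w' x := index (w x) s.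
have w'_le x y : (w' x <= w' y) = (w x <= w y).
  apply/idP/idP => [|le_w].
    apply: (sorted_leq_index leq_trans leqnn s_sorted) => //.
  rewrite leqNgt; apply/negP => lt_w'.
  have /eqP : w x = w y.
    apply/anti_leq; rewrite le_w /=.
    exact: (sorted_ltn_index leq_trans s_sorted).
  by move=> /eqP E; move: lt_w'; rewrite /w' E ltnn.
exists [seq level v | v <- s].
  rewrite /ordered_partition map_inj_in_uniq // s_uniq /=.
  apply/and3P; split.
  - apply/eqP/setP => x; rewrite [RHS]inE; apply/bigcupP; exists (level (w x)).
      by rewrite inE map_f.
    by rewrite inE.
  - apply/trivIsetP => Q Q'; rewrite !inE => /mapP[u us ->] /mapP[v vs ->] uv.
    rewrite -setI_eq0; apply/eqP/setP => x; rewrite !inE.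
    by apply: contraNF uv => /andP[/eqP <- /eqP <-].
  - rewrite inE; apply/mapP => -[v].
    rewrite mem_sort mem_undup => /codomP[x ->].
    by move=> /setP/(_ x); rewrite !inE eqxx.
apply/ffunP => k; rewrite ffunE Bw (last_block_top (w := w')) ?nd_type_neq0 //.
- by apply/setP => x; rewrite !inE; under eq_forallb do rewrite -w'_le.
- by move=> x; rewrite size_map index_mem.
move=> x m; rewrite size_map => m_lt; rewrite (nth_map 0) // inE /w'.
apply/eqP/eqP => [->|<-]; first exact: index_uniq.
by rewrite nth_index.
Qed.

Lemma top_type_subproof w A : [forall k, [ffun k => top_set w (A k)] k != set0].
Proof. by apply/forallP => k; rewrite ffunE top_set_neq0 ?nd_type_neq0. Qed.

Definition top_type w A : nd_type n d := NdType (top_type_subproof w A).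

Lemma top_typeE w A k : top_type w A k = top_set w (A k).
Proof. by rewrite ffunE. Qed.

(** The type met after an infinitesimal move in the direction of the
    complement of [X]. *)
Definition away_type X A : nd_type n d := top_type (fun x => x \in ~: X) A.

Lemma away_typeE X A k :
  away_type X A k = if A k \subset X then A k else A k :\: X.
Proof. by rewrite top_typeE top_set_indicator -setDE setD_eq0. Qed.

Lemma away_type_sub X A k : away_type X A k \subset A k.
Proof. by rewrite top_typeE top_set_sub. Qed.

Lemma nd_type_disjoint A X Y k :
  [disjoint X & Y] -> A k \subset X -> ~~ (A k \subset Y).
Proof.
move=> /disjoint_setI0 XY AX; apply/negP => AY.
have /set0Pn[x xA] := nd_type_neq0 A k.
by move/setP/(_ x): XY; rewrite in_setI (subsetP AX) // (subsetP AY) // inE.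
Qed.

Lemma refinement_trans A B C :
  refinement A B -> refinement B C -> refinement A C.
Proof.
move=> /refinement_topP[w2 AB] /refinement_topP[w1 BC]; apply/refinement_topP.
by eexists => k; rewrite AB BC top_set_comp.
Qed.

Lemma refinement_refl A : refinement A A.
Proof.
apply/refinement_topP; exists (fun=> 0) => k; apply/setP => x.
by apply/idP/top_setP => [|[]].
Qed.

End Refinement.

(** * Reachability in the comparability graph *)

Section Reachability.
Variables (n d : nat) (A B : nd_type n d).
Implicit Types X : {set 'I_d}.

Definition cg_step : rel 'I_d :=
  fun u v => [exists e, (e \in cg_edges A B) && cg_traverses A B e u v].

Definition cg_reach (X : {set 'I_d}) : {set 'I_d} :=
  [set y | [exists x in X, connect cg_step x y]].

Lemma cg_reachP X y :
  reflect (exists2 x, x \in X & connect cg_step x y) (y \in cg_reach X).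
Proof. by rewrite inE; apply: exists_inP. Qed.

Lemma sub_cg_reach X : X \subset cg_reach X.
Proof. by apply/subsetP => x xX; apply/cg_reachP; exists x. Qed.

Lemma cg_reach_closed X k a :
  a \in A k -> a \in cg_reach X -> B k \subset cg_reach X.
Proof.
move=> aA /cg_reachP[x xX xa]; apply/subsetP => b bB.
apply/cg_reachP; exists x => //; apply: connect_trans xa (connect1 _).
by apply/existsP; exists (k, a, b); rewrite inE aA bB /= !eqxx.
Qed.

Lemma connect_cg_walk a b : connect cg_step a b -> exists s, cg_walk A B a s b.
Proof.
case/connectP => p; elim: p a => [|c p IHp] a /= => [_ ->|].
  by exists [::] => /=.
case/andP=> /existsP[e /andP[eE et]] /IHp/[apply] -[s sP].
by exists ((e, c) :: s); rewrite /= eE et.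
Qed.

(** Acyclicity in the form in which it is used: an edge from [a] to [b] that is
    directed cannot be closed up by a path from [b] to [a], whether or not
    that path contains another directed edge. *)
Lemma acyclic_no_return k a b : cg_acyclic A B ->
    a \in A k -> b \in B k -> ~~ ((a \in B k) && (b \in A k)) ->
  ~~ connect cg_step b a.
Proof.
move=> acyc aA bB dir; apply/negP => /connect_cg_walk[s sP].
case: (acyc a); exists (((k, a, b), b) :: s) => /=.
  by rewrite inE aA bB !eqxx.
by rewrite !inE aA bB /= andbT dir.
Qed.

End Reachability.

(** * Sliding towards a type by elimination *)

Section Matroid.
Variables (n d : nat) (M : {set nd_type n d}).
Hypothesis tomM : tropical_oriented_matroid M.
Implicit Types (A B C : nd_type n d) (I : {set 'I_n}) (X J L : {set 'I_d}).

Lemma top_type_in w A : A \in M -> top_type w A \in M.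
Proof.
move=> AM; apply: (tom_surrounding tomM AM); apply/refinement_topP.
by exists w => k; rewrite top_typeE.
Qed.

(** Start from B and keep eliminating with A, at a position of I where the
    current type still equals B k and does not contain A k. Positions already
    at A k or A k :|: B k stay so, and the position just eliminated becomes
    A k :|: B k, hence differs from A k: the result never collapses to A. *)
Lemma eliminate_towards A B I :
    A \in M -> B \in M ->
    (forall k, k \in I -> B k \subset A k -> B k = A k) ->
    (exists2 k, k \in I & B k != A k) ->
  exists R, [/\ R \in M,
    forall k, R k \in [:: A k; B k; A k :|: B k],
    forall k, k \in I -> R k \in [:: A k; A k :|: B k] &
    exists2 k, k \in I & R k != A k].
Proof.
move=> AM BM BsubA neqBA.
pose bad (R : nd_type n d) := [set k in I | R k \notin [:: A k; A k :|: B k]].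
suff ind m (R : nd_type n d) : #|bad R| <= m -> R \in M ->
    (forall k, R k \in [:: A k; B k; A k :|: B k]) ->
    (exists2 k, k \in I & R k != A k) ->
  exists R, [/\ R \in M,
    forall k, R k \in [:: A k; B k; A k :|: B k],
    forall k, k \in I -> R k \in [:: A k; A k :|: B k] &
    exists2 k, k \in I & R k != A k].
  by apply: (ind _ B (leqnn _)) => // k; rewrite !inE eqxx orbT.
elim: m R => [|m IHm] R badR RM RAB neqRA.
  exists R; split=> // k kI; move: badR; rewrite leqn0 cards_eq0.
  by move/eqP/setP/(_ k); rewrite !inE kI /= => /negbFE.
case: (set_0Vmem (bad R)) => [bad0|[i]].
  by apply: (IHm R) => //; rewrite bad0 cards0.
rewrite inE => /andP[iI ibad].
have RiB : R i = B i.
  by move: (RAB i) ibad; rewrite !inE => /or3P[]/eqP-> //; rewrite !eqxx ?orbT.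
have [R' [R'M R'i R'k]] := tom_elimination tomM AM RM i.
rewrite RiB in R'i.
apply: (IHm R') => //.
- rewrite -ltnS; apply: leq_trans badR; apply: proper_card; apply/properP.
  split; last first.
    by exists i; rewrite !inE ?R'i ?eqxx ?orbT //= iI; rewrite !inE in ibad.
  apply/subsetP => k; rewrite !inE => /andP[kI /norP[R'1 R'2]]; rewrite kI /=.
  move: (R'k k); rewrite !inE (negbTE R'1) /=.
  apply: contraTN => /orP[]/eqP RkE; rewrite RkE.
    by rewrite setUid (negbTE R'1).
  by rewrite setUA setUid (negbTE R'2).
- move=> k; move: (R'k k) (RAB k); rewrite !inE.
  by case/or3P=> /eqP-> /or3P[]/eqP RkE;
    rewrite ?RkE ?setUid ?setUA ?setUid ?eqxx ?orbT.
- exists i => //; rewrite R'i; apply: contraNneq ibad => ABi.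
  rewrite RiB BsubA // ?inE ?eqxx //.
  by rewrite -ABi subsetUr.
Qed.

(** * Descent to a type that covers the given degrees *)

(** Up to the constant [\sum_(k in I) #|A k|], this is the defect of Hall's
    condition at [X]: the demand of the positions whose set is confined to [X],
    minus the supply [\sum_(k in I) #|A k :&: X|]. Counting [A k :\: X]
    instead of subtracting [A k :&: X] keeps the function in [nat]. *)
Definition excess I A C X : nat :=
  \sum_(k in I) ((C k \subset X) * #|A k| + #|A k :\: X|).

(** The identity holds term by term: a set inside [X] is kept, and lies in [Y]
    iff it lies in [X :&: Y]; any other set loses its part in [X], and what
    is left lies in [Y] iff the set lies in [X :|: Y]. When [X] maximises the excess of [C],
    the refinement does not exceed that maximum either, and attains it at [Y]
    only if [C] attains it at both [X :&: Y] and [X :|: Y]. *)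
Lemma excess_refine I A C X Y :
  excess I A (away_type X C) Y + excess I A C X =
  excess I A C (X :&: Y) + excess I A C (X :|: Y).
Proof.
rewrite /excess -!big_split /=; apply: eq_bigr => k _.
have cardsA : #|A k :\: Y| + #|A k :\: X| =
    #|A k :\: (X :&: Y)| + #|A k :\: (X :|: Y)|.
  by rewrite setDIr setDUr addnC cardsUI.
rewrite away_typeE !mulnbl subsetI.
have [CX|/negbTE CX] := boolP (C k \subset X).
  by rewrite (subset_trans CX (subsetUl _ _)) addnACA cardsA addnACA.
by rewrite subDset addnACA cardsA [X in X + _]addnC addnACA.
Qed.

(** The far end of the ray starting at [A] in the direction of [L]. *)
Definition contracts_to L := forall A, A \in M ->
  (forall k, (A k \subset L) || [disjoint A k & L]) ->
  exists2 B, B \in M &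
    forall k, B k \subset L /\ (A k \subset L -> B k = A k).

(** One round of the descent lowers the maximum of the excess, by removing one
    after the other the sets at which it is attained. *)
Lemma excess_bound_step L I A C m :
    (forall J, J != set0 -> J \proper L -> contracts_to J) ->
    (forall k, k \in I -> A k \subset L) ->
    C \in M -> (forall k, C k \subset L) ->
    (forall X, excess I A C X <= m) -> \sum_(k in I) #|A k| < m ->
  exists2 C', C' \in M & (forall k, C' k \subset L) /\
    forall X, excess I A C' X < m.
Proof.
move=> contrL AL CM CL Cm Sm.
pose peaks C := [set X | excess I A C X == m].
have [N] := ubnP #|peaks C|.
elim: N => // N IHN in C CM CL Cm *; rewrite ltnS => peaksN.
case: (set_0Vmem (peaks C)) => [peaks0|[X0 X0peak]].
  exists C => //; split=> // X; rewrite ltn_neqAle Cm andbT.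
  by move/setP/(_ X): peaks0; rewrite !inE => ->.
rewrite inE in X0peak.
(* Among the sets of maximal excess, one of maximal cardinality: any Y such
   that X :|: Y also has maximal excess is then contained in X. *)
case: (@arg_maxnP _ X0 (fun X => excess I A C X == m) (fun X => #|X|) X0peak).
move=> X /eqP Xm Xmax.
have excess_trivial (Y : {set 'I_d}) :
  (forall k, k \in I -> (C k \subset Y) * #|A k| + #|A k :\: Y| = #|A k|) ->
    excess I A C Y <> m.
  by move=> YP Ym; move: Sm; rewrite -Ym /excess (eq_bigr _ YP) ltnn.
pose J := L :\: X.
have J0 : J != set0.
  apply/negP; rewrite setD_eq0 => LX; apply: (excess_trivial X) Xm => k kI.
  rewrite (subset_trans (CL k) LX) mul1n.
  have /eqP -> : A k :\: X == set0.
    by rewrite setD_eq0 (subset_trans (AL k kI) LX).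
  by rewrite cards0 addn0.
have JL : J \proper L.
  rewrite properEneq subsetDl andbT; apply/negP => /eqP/setDidPl LX.
  apply: (excess_trivial X) Xm => k kI.
  have /negbTE -> := nd_type_disjoint LX (CL k).
  have /setDidPl -> // : [disjoint A k & X] by apply: disjointWl LX; exact: AL.
pose C1 := away_type X C.
have C1M : C1 \in M by exact: top_type_in.
have C1J k : C1 k \subset (if C k \subset X then X else J).
  by rewrite away_typeE; case: ifP => // _; rewrite setSD.
have disjJX : [disjoint J & X] by rewrite -setI_eq0 setIDAC -setIDA setDv setI0.
have C1_disj k : C k \subset X -> [disjoint C1 k & J].
  by move=> CX; rewrite disjoint_sym (disjointWr _ disjJX) //;
    have := C1J k; rewrite CX.
have [|B BM BP] := contrL J J0 JL C1 C1M.
  by move=> k; have := C1J k; case: ifP => [/C1_disj->|_ ->]; rewrite ?orbT.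
have BneqC1 k : C k \subset X -> ~~ (B k \subset C1 k).
  move=> CX; apply: nd_type_disjoint (BP k).1.
  by rewrite disjoint_sym C1_disj.
have BeqC1 k : ~~ (C k \subset X) -> B k = C1 k.
  by move=> /negbTE CX; apply: (BP k).2; move: (C1J k); rewrite CX.
have [k0 k0I Ck0X] : exists2 k, k \in I & C k \subset X.
  apply/exists_inP; apply: contraLR Sm => /exists_inPn noC.
  rewrite -leqNgt -Xm; apply: leq_sum => k /noC/negbTE ->.
  by rewrite subset_leq_card ?subsetDl.
have [||C2 [C2M C2P C2I [i iI C2i]]] := @eliminate_towards C1 B I C1M BM.
- move=> k _; have [/BneqC1/negbTE -> //|/BeqC1 //] := boolP (C k \subset X).
- by exists k0 => //; apply: contraNneq (BneqC1 k0 Ck0X) => ->.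
have C1L k : C1 k \subset L := subset_trans (away_type_sub X C k) (CL k).
have C2L k : C2 k \subset L.
  have BL : B k \subset L := subset_trans (BP k).1 (proper_sub JL).
  by move: (C2P k); rewrite !inE => /or3P[]/eqP->; rewrite // subUset C1L.
(* Enlarging the sets of a type can only decrease its excess. *)
have C12k (Y : {set 'I_d}) k : k \in I ->
    (C2 k \subset Y) * #|A k| + #|A k :\: Y| <=
    (C1 k \subset Y) * #|A k| + #|A k :\: Y|.
  move=> kI; rewrite leq_add2r leq_mul2r orbC.
  have C1C2 : C1 k \subset C2 k.
    by move: (C2I k kI); rewrite !inE => /orP[]/eqP->; rewrite ?subsetUl.
  by case: (boolP (C2 k \subset Y)) => // /(subset_trans C1C2) ->.
have C12 Y : excess I A C2 Y <= excess I A C1 Y.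
  by apply: leq_sum => k; exact: C12k.
(* At X the excess drops, because the set at position i was confined to X
   and acquires elements of J. *)
have C12X : excess I A C2 X < excess I A C1 X.
  have CiX : C i \subset X.
    apply: contraNT C2i => /BeqC1 BC.
    by move: (C2I i iI); rewrite !inE BC setUid orbb.
  have C1iX : C1 i \subset X by move: (C1J i); rewrite CiX.
  have C2iX : C2 i \subset X = false.
    move: (C2I i iI); rewrite !inE (negbTE C2i) /= => /eqP ->.
    apply: contraNF (nd_type_disjoint disjJX (BP i).1).
    by rewrite subUset => /andP[].
  rewrite /excess (bigD1 i) //= [X in _ < X](bigD1 i) //= C1iX C2iX.
  rewrite -addSn leq_add //.
    by rewrite ltn_add2r mul0n mul1n card_gt0 nd_type_neq0.
  by apply: leq_sum => k /andP[kI _]; exact: C12k.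
have C1m Y : excess I A C1 Y <= m.
  have := excess_refine I A C X Y; rewrite -/C1 Xm.
  by have := Cm (X :&: Y); have := Cm (X :|: Y); lia.
apply: (IHN C2 C2M C2L) => [Y|]; first exact: leq_trans (C12 Y) (C1m Y).
(* The maximum m is now attained at fewer sets: no new ones by the choice of
   X, and no longer at X. *)
apply: leq_trans peaksN; apply: proper_card; apply/properP; split.
  apply/subsetP => Y; rewrite !inE => /eqP C2Y.
  have C1Y : excess I A C1 Y = m by have := C12 Y; have := C1m Y; lia.
  have := excess_refine I A C X Y; rewrite -/C1 C1Y Xm => sumXY.
  have := Cm (X :&: Y); have := Cm (X :|: Y) => mU mI.
  have XU : X :|: Y = X.
    apply/eqP; rewrite eq_sym eqEcard subsetUl /=; apply: Xmax.
    by apply/eqP; lia.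
  have /setIidPr YX : Y \subset X by rewrite -XU subsetUr.
  by rewrite -{1}YX; apply/eqP; lia.
exists X; rewrite inE ?Xm // neq_ltn.
by rewrite (leq_trans C12X).
Qed.

(** Repeated from a boundary type, the descent reaches Hall's condition. *)
Lemma excess_bounded L I A :
    L != set0 ->
    (forall J, J != set0 -> J \proper L -> contracts_to J) ->
    (forall k, k \in I -> A k \subset L) ->
  exists2 C, C \in M & (forall k, C k \subset L) /\
    forall X, excess I A C X <= \sum_(k in I) #|A k|.
Proof.
move=> /set0Pn[j jL] contrL AL; set S := \sum_(k in I) _.
suff desc m C : C \in M -> (forall k, C k \subset L) ->
    (forall X, excess I A C X <= S + m) ->
  exists2 C, C \in M & (forall k, C k \subset L) /\
    forall X, excess I A C X <= S.
  pose Cj := const_nd_type n j.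
  apply: (desc (\max_X excess I A Cj X)) (tom_boundary tomM j) _ _.
    by move=> k; rewrite ffunE sub1set.
  by move=> X; apply: leq_trans (leq_addl _ _); apply: leq_bigmax.
elim: m C => [|m IHm] C CM CL.
  by exists C => //; split=> // X; rewrite -(addn0 S).
move=> Cm; have [|C' C'M [C'L C'm]] := excess_bound_step contrL AL CM CL Cm.
  by rewrite addnS ltnS leq_addr.
by apply: (IHm C') => // X; have := C'm X; rewrite addnS.
Qed.

(** Let X be the set reachable from C k in the comparability graph. For every
    i, either A i is disjoint from X, or C i lies in X by closure; so the i-th
    term of the excess at X is at least #|A i|, and the bound makes all of
    these inequalities equalities. At i = k this says that A k lies in X. An
    element of A k outside C k would then be reachable from some c in C k,
    although it is joined to c by a directed edge. *)
Lemma excess_bounded_sub I A C : A \in M -> C \in M ->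
    (forall X, excess I A C X <= \sum_(k in I) #|A k|) ->
  forall k, k \in I -> A k \subset C k.
Proof.
move=> AM CM Cexc k kI; have acyc := tom_comparability tomM AM CM.
set X := cg_reach A C (C k).
have term_ge i : i \in I -> #|A i| <= (C i \subset X) * #|A i| + #|A i :\: X|.
  move=> _; case: (boolP [disjoint A i & X]) => [/setDidPl->|].
    exact: leq_addl.
  case/pred0Pn=> a /andP[aA aX].
  by rewrite (cg_reach_closed aA aX) mul1n leq_addr.
have AX : A k \subset X.
  rewrite -setD_eq0 -cards_eq0 -leqn0 -(leq_add2l #|A k|) addn0.
  have := Cexc X; rewrite /excess (bigD1 k) //= [X in _ <= X](bigD1 k) //=.
  rewrite sub_cg_reach mul1n => le_sum.
  rewrite -(leq_add2r (\sum_(i in I | i != k) #|A i|)).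
  apply: leq_trans le_sum; rewrite leq_add2l; apply: leq_sum => i /andP[iI _].
  exact: term_ge.
apply/subsetP => a aA; apply/negPn/negP => aC.
have /cg_reachP[c cC ca] := subsetP AX a aA.
by have := acyclic_no_return acyc aA cC; rewrite negb_and aC ca => /(_ isT).
Qed.

(** If c belongs to C i and not to A i, let X be the set reachable from c. It
    misses A i, since the edges from A i to c are directed, so C i is not
    contained in X. Refining away from X thus removes c from C i; and wherever
    A k meets X the set C k lies in X and is unchanged, so that A k remains
    contained in it. *)
Lemma refine_to_sub L I A C : A \in M -> C \in M -> (forall k, C k \subset L) ->
    (forall k, k \in I -> A k \subset C k) ->
  exists2 B, B \in M &
    (forall k, B k \subset L) /\ forall k, k \in I -> B k = A k.
Proof.
move=> AM; have [m] := ubnP (\sum_k #|C k|).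
elim: m C => // m IHm C; rewrite ltnS => Cm CM CL AC.
case: (boolP [forall k in I, C k == A k]) => [/forall_inP CA|].
  by exists C => //; split=> // k /CA/eqP.
case/forall_inPn=> i iI neqCA.
have /subsetPn[c cC cA] : ~~ (C i \subset A i).
  by apply: contra neqCA => CA; rewrite eqEsubset CA AC.
have acyc := tom_comparability tomM AM CM.
set X := cg_reach A C [set c].
have cX : c \in X by rewrite (subsetP (sub_cg_reach _ _ _)) ?set11.
pose C' := away_type X C.
have C'C k : C' k \subset C k := away_type_sub X C k.
apply: (IHm C'); rewrite ?top_type_in //.
- apply: leq_trans Cm; rewrite (bigD1 i) //= [X in _ < X](bigD1 i) //= -addSn.
  apply: leq_add; last by apply: leq_sum => k _; exact/subset_leq_card.
  apply: proper_card; apply/properP; split=> //; exists c => //.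
  rewrite away_typeE; case: ifP => [CX|_]; last by rewrite inE cX.
  have /set0Pn[a aA] := nd_type_neq0 A i.
  have /cg_reachP[_ /set1P-> ca] := subsetP CX a (subsetP (AC i iI) a aA).
  have := acyclic_no_return acyc aA cC.
  by rewrite negb_and cA orbT ca => /(_ isT).
- by move=> k; apply: subset_trans (C'C k) (CL k).
- move=> k kI; rewrite away_typeE; case: ifPn => [_|CX]; first exact: AC.
  rewrite subsetD AC //=; apply: contraNT CX => /pred0Pn[a /andP[aA aX]].
  exact: cg_reach_closed aA aX.
Qed.

(** * The coarsening of a type that is not a vertex *)

Lemma contraction L : L != set0 -> contracts_to L.
Proof.
have [m] := ubnP #|L|.
elim: m L => // m IHm L; rewrite ltnS => Lm L0 A AM Asplit.
pose I := [set k | A k \subset L].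
have [||C CM [CL Cexc]] := @excess_bounded L I A L0.
- move=> J J0 /proper_card JL; apply: IHm => //; exact: leq_trans JL Lm.
- by move=> k; rewrite inE.
have [B BM [BL BA]] := refine_to_sub AM CM CL (excess_bounded_sub AM CM Cexc).
by exists B => // k; split=> // AkL; apply: BA; rewrite inE.
Qed.

(** The position k0, whose set is disjoint from J, ensures that the far end of
    the ray differs from A, so that the sliding meets a new type. *)
Lemma coarsen_disconnected A k0 J : A \in M -> J != set0 ->
    (forall k, (A k \subset J) || [disjoint A k & J]) -> [disjoint A k0 & J] ->
  exists2 C, C \in M & refinement A C /\ \sum_k #|A k| < \sum_k #|C k|.
Proof.
move=> AM J0 Asplit Ak0; have [B BM BP] := contraction J0 AM Asplit.
have BnotA k : [disjoint A k & J] -> ~~ (B k \subset A k).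
  by rewrite disjoint_sym => JA; exact: nd_type_disjoint JA (BP k).1.
have [||C [CM _ CI [i _ Ci]]] := @eliminate_towards A B setT AM BM.
- by move=> k _; case/orP: (Asplit k) => [/(BP k).2//|/BnotA/negbTE->].
- by exists k0; rewrite ?inE //; apply: contraNneq (BnotA k0 Ak0) => ->.
have CE k : C k = A k \/ C k = A k :|: B k.
  by move: (CI k (in_setT k)); rewrite !inE => /orP[]/eqP; [left|right].
have AC k : A k \subset C k by case: (CE k) => ->; rewrite ?subsetUl.
exists C => //; split.
  apply/refinement_topP; exists (fun x => x \in ~: J) => k.
  rewrite -[RHS]top_typeE -/(away_type J C) away_typeE.
  case/orP: (Asplit k) => [AJ|AJ].
    have CA : C k = A k by case: (CE k) => -> //; rewrite (BP k).2 // setUid.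
    by rewrite CA AJ.
  have /negbTE -> : ~~ (C k \subset J).
    apply: contra (nd_type_disjoint AJ (subxx _)); exact: subset_trans (AC k).
  case: (CE k) => ->; first by apply/esym/setDidPl.
  have /eqP BJ0 : B k :\: J == set0 by rewrite setD_eq0 (BP k).1.
  by rewrite setDUl (setDidPl AJ) BJ0 setU0.
rewrite (bigD1 i) //= [X in _ < X](bigD1 i) //= -addSn.
apply: leq_add; last by apply: leq_sum => k _; exact/subset_leq_card.
by apply: proper_card; rewrite properEneq eq_sym Ci AC.
Qed.

End Matroid.

Lemma type_adj_sym n d (A : nd_type n d) : symmetric (type_adj A).
Proof. by move=> i j; apply: eq_existsb => k; rewrite andbC. Qed.

Theorem theorem4p6 (n d : nat) (M : {set nd_type n d}) :
  0 < n -> tropical_oriented_matroid M ->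
  forall A : nd_type n d, A \in M ->
  exists V : nd_type n d, tom_vertex M V /\ refinement A V.
Proof.
move=> n_gt0 tomM A.
have [m] := ubnP (n * d - \sum_k #|A k|).
elim: m A => // m IHm A; rewrite ltnS => Am AM.
have adj_sym := sym_connect_sym (type_adj_sym A).
case: (boolP [forall i, forall j, connect (type_adj A) i j]) => [conn|].
  exists A; split; last exact: refinement_refl.
  by split=> // i j; have /forallP/(_ i)/forallP := conn.
move=> disconn; pose k0 : 'I_n := Ordinal n_gt0.
have /set0Pn[a aA] := nd_type_neq0 A k0.
(* The ray goes in the direction of the complement of the component K of a.
   It contains A k0, so that some set is left to grow. *)
pose K := [set y | connect (type_adj A) a y].
have A_sub_K k x : x \in A k -> x \in K -> A k \subset K.
  rewrite !inE => xA ax; apply/subsetP => y yA; rewrite inE.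
  apply: connect_trans ax (connect1 _).
  by apply/existsP; exists k; rewrite xA.
have [|k||C CM [refAC ltAC]] := @coarsen_disconnected n d M tomM A k0 (~: K) AM.
- apply: contraNneq disconn => K0; apply/forallP => i; apply/forallP => j.
  have inK x : connect (type_adj A) a x.
    by move/setP/(_ x): K0; rewrite !inE => /negbFE.
  by apply: connect_trans (inK j); rewrite adj_sym.
- rewrite -subsets_disjoint orbC; case: (boolP (A k \subset K)) => //= AK.
  apply/subsetP => x xA; rewrite inE; apply: contra AK; exact: A_sub_K.
- by rewrite -subsets_disjoint (A_sub_K _ a) // inE.
have C_le : \sum_k #|C k| <= n * d.
  have -> : n * d = \sum_(k < n) d by rewrite sum_nat_const card_ord.
  by apply: leq_sum => k _; rewrite -[X in _ <= X]card_ord max_card.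
have [|V [VM refCV]] := IHm C _ CM; first lia.
by exists V; split=> //; apply: refinement_trans refCV.
Qed.
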